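(* Let $U$ and $V$ be unitaries on $\mathbb{C}^d$, let $\mathcal{T}=\{1,\dots,6\}$, and let $\mathtt{QS}$, $\mathtt{U}$, $\mathtt{V}$ be the systems described in the context. The composition of $\mathtt{QS}$, $\mathtt{U}$ and $\mathtt{V}$ (connecting wires $C$, $D$ between $\mathtt{QS}$ and $\mathtt{U}$, and wires $E$, $F$ between $\mathtt{QS}$ and $\mathtt{V}$) results in a system which performs a controlled switch between the orders of $U$ and $V$: for every input $(\alpha|0\rangle_A+\beta|1\rangle_A)\otimes|\psi\rangle_B$ in position $t=1$, with $|\psi\rangle\in\mathbb{C}^d$ and counters of $\mathtt{U}$ and $\mathtt{V}$ initialized to $|0\rangle$, the output on wires $G,H$ in position $t=6$ is $$\alpha|0\rangle_G\otimes UV|\psi\rangle_H+\beta|1\rangle_G\otimes VU|\psi\rangle_H .$$ Furthermore, the boxes $\mathtt{U}$ and $\mathtt{V}$ are queried only once each, i.e. the final state of their counters is $|1\rangle_{\mathtt{U}}\otimes|1\rangle_{\mathtt{V}}$ (in tensor product with the output).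
   Context: Each wire carries states in the bosonic Fock space $\mathcal{F}(\mathbb{C}^{d'}\otimes\ell^2(\mathcal{T}))=\bigoplus_{n\ge0}\vee^n(\mathbb{C}^{d'}\otimes\ell^2(\mathcal{T}))$ with vacuum $|\Omega\rangle$ (meaning ''no message''); $|\psi_t\rangle=|\psi\rangle\otimes|t\rangle$ is the message $\psi$ in position $t\in\mathcal{T}$. Wires $A,G$ have $d'=2$; wires $B,C,D,E,F,H$ have $d'=d$. $\mathtt{QS}$ has input wires $A,B$ (external), $D$ (from $\mathtt{U}$), $F$ (from $\mathtt{V}$) and output wires $C$ (to $\mathtt{U}$), $E$ (to $\mathtt{V}$), $G,H$ (external). System $\mathtt{U}$ has input wire $C$, output wire $D$ and an internal counter register, also denoted $\mathtt{U}$, with basis $\{|i\rangle\}_{i\in\mathbb{N}_0}$. For $n\ge1$ and $|\psi^n_t\rangle\in\vee^n(\mathbb{C}^d\otimes|t\rangle)$ ($n$ messages all arriving in position $t$): $|\Omega\rangle_C\otimes|i\rangle_{\mathtt{U}}\mapsto|\Omega\rangle_D\otimes|i\rangle_{\mathtt{U}}$ and $|\psi^n_t\rangle_C\otimes|i\rangle_{\mathtt{U}}\mapsto|(U^{\otimes n}\psi^n)_{t+1}\rangle_D\otimes|i+n\rangle_{\mathtt{U}}$. System $\mathtt{V}$ is defined in the same way with $V$, input wire $E$, output wire $F$ and counter register $\mathtt{V}$. System $\mathtt{QS}$ has an internal register, denoted $\mathtt{QS}$, for a control qubit and acts as follows on valid inputs (any state orthogonal to these is ignored). Inputs in position $1$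 are mapped to outputs in position $2$ by $|0\rangle_A|\psi\rangle_B\mapsto|0\rangle_{\mathtt{QS}}|\Omega\rangle_C|\psi\rangle_E$ and $|1\rangle_A|\psi\rangle_B\mapsto|1\rangle_{\mathtt{QS}}|\psi\rangle_C|\Omega\rangle_E$. Inputs in position $3$ are mapped to outputs in position $4$ by $|\psi\rangle_D|\varphi\rangle_F\mapsto|\varphi\rangle_C|\psi\rangle_E$ (either of which may be the vacuum). Inputs in position $5$ are mapped to outputs in position $6$ by $|0\rangle_{\mathtt{QS}}|\psi\rangle_D|\Omega\rangle_F\mapsto|0\rangle_G|\psi\rangle_H$ and $|1\rangle_{\mathtt{QS}}|\Omega\rangle_D|\psi\rangle_F\mapsto|1\rangle_G|\psi\rangle_H$. All maps extend linearly. Composition means that messages output on a connected wire in position $t$ are the input, in the same position $t$, of the system at the other end. *)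

(* Defs.v *)
From HB Require Import structures.
From mathcomp Require Import all_boot all_order all_algebra.
From mathcomp Require Import all_classical all_reals all_analysis.
From mathcomp Require Export complex.

Set Implicit Arguments.
Unset Strict Implicit.
Unset Printing Implicit Defensive.

Import Order.TTheory GRing.Theory Num.Theory.

Local Open Scope ring_scope.
Local Open Scope complex_scope.

(* The set of positions {1, ..., 6}: 'I_6 starts at 0, so the position k is
   represented by the ordinal k - 1; [pos k] is meaningful for 1 <= k <= 6. *)
Definition position := 'I_6.
Definition pos (k : nat) : position := inord k.-1.

Inductive wire := wA | wB | wC | wD | wE | wF | wG | wH.

Lemma wire_eq_dec : comparable wire.
Proof. by move=> w w'; rewrite /decidable; decide equality. Defined.

HB.instance Definition _ := hasDecEq.Build wire (compareP wire_eq_dec).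

Definition wires : seq wire := [:: wA; wB; wC; wD; wE; wF; wG; wH].

Definition wdim (d : nat) (w : wire) : nat :=
  match w with wA | wG => 2 | _ => d end.

(* The basis |i> (x) |t> of the one-message space C^k (x) l^2(T). *)
Definition message (k : nat) : Type := ('I_k * position)%type.

(* A basis element of the full (unsymmetrised) Fock space of every wire: the
   word [c w] of length n indexes a basis of the n-th tensor power of the
   one-message space of w. *)
Definition config (d : nat) : Type :=
  forall w : wire, seq (message (wdim d w)).

(* Amplitudes of a joint vector of the eight wires and a register with
   orthonormal basis M.  Those that are vectors of the Hilbert space
   (bosonic Fock spaces) (x) l^2(M) are singled out by [bosonic] and
   [square_summable] below. *)
Definition state (R : realType) (d : nat) (M : Type) : Type :=
  config d -> M -> R[i].

Section Fock.
Variables (R : realType) (d : nat).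

Definition bosonic (M : Type) (f : state R d M) : Prop :=
  forall (c c' : config d) (m : M),
    (forall w, perm_eq (c w) (c' w)) -> f c m = f c' m.

(* The n-th symmetric power is realised as the space of symmetric functions of
   n arguments with squared norm (1/n!) sum |f|^2.  With this normalisation
   F(H1 (+) H2) = F(H1) (x) F(H2) is f(s1, s2) = f(s1 ++ s2), without the
   square root of a binomial coefficient; [step] below relies on this. *)
Definition square_summable (M : choiceType) (f : state R d M) : Prop :=
  (\esum_(x in [set: (config d * M)%type])
     ((complex.Re `|f x.1 x.2|) ^+ 2 /
        (\prod_(w <- wires) (size (x.1 w))`!)%:R)%:E < +oo)%E.

Definition in_position (t : position) {k : nat} : pred (message k) :=
  fun x => x.2 == t.

(* All messages of c are on wires of W and in position t. *)
Definition located (W : seq wire) (t : position) (c : config d) : bool :=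
  all (fun w => if w \in W then all (in_position t) (c w) else c w == [::])
      wires.

(* The Fock space of the messages on the wires W in position t (all other
   wires and positions in the vacuum), tensored with l^2(M). *)
Definition fock (W : seq wire) (t : position) (M : choiceType)
    (f : state R d M) : Prop :=
  [/\ bosonic f, square_summable f &
      forall c m, ~~ located W t c -> f c m = 0].

(* A system with input wires I, output wires O and internal register M.  Its
   action [act t] takes the inputs in position t to outputs in position t + 1;
   it is unconstrained outside the Fock space [fock I (pos t)]. *)
Record system (I O : seq wire) (M : choiceType) := System {
  act :> nat -> state R d M -> state R d M;
  act_fock : forall t f, (1 <= t < 6)%N ->
    fock I (pos t) f -> fock O (pos t.+1) (act t f);
  act_linear : forall t (a : R[i]) f g, (1 <= t < 6)%N ->
    fock I (pos t) f -> fock I (pos t) g ->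
    act t (fun c m => a * f c m + g c m)
      = (fun c m => a * act t f c m + act t g c m)
}.

(* The action at time t of a system on the joint state of all wires and of all
   registers N, where get and put read and write the component M of N, that is,
   (act t) (x) identity.  For fixed messages c and register content m outside
   the reach of the system, the amplitude of the input x, i is the amplitude of
   the joint state with x added to c.  Afterwards the input wires have no
   messages in position t left.  The output wires have to be in the vacuum in
   position t + 1 beforehand: nothing else writes to them. *)
Definition step (I O : seq wire) (M : choiceType) (N : Type)
    (get : N -> M) (put : M -> N -> N) (S : system I O M) (t : nat)
    (psi : state R d N) : state R d N :=
  fun c m =>
    if has (fun w => (w \in I) && has (in_position (pos t)) (c w)) wires then 0
    else
      S t
        (fun x i =>
           if located I (pos t) x then
             psi (fun w => x w ++
                    (if w \in O
                     then [seq y <- c w | ~~ in_position (pos t.+1) y]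
                     else c w))
                 (put i m)
           else 0)
        (fun w => if w \in O
                  then [seq y <- c w | in_position (pos t.+1) y] else [::])
        (get m).

End Fock.

Section Vectors.
Variables (R : realType) (d : nat).

Definition wvec (k : nat) : Type := seq (message k) -> R[i].

Definition vacuum {k : nat} : wvec k := fun s => (s == [::])%:R.

(* |psi_t> for psi in the n-th tensor power of C^k, up to the factor sqrt(n!) of
   the normalisation chosen above (no factor for n = 1). *)
Definition messages (k n : nat) (psi : {ffun n.-tuple 'I_k -> R[i]})
    (t : nat) : wvec k :=
  fun s =>
    if all (in_position (pos t)) s then
      if insub (map fst s) is Some u then psi u else 0
    else 0.

Definition message1 (k : nat) (v : 'cV[R[i]]_k) (t : nat) : wvec k :=
  messages [ffun u : 1.-tuple 'I_k => v (tnth u ord0) 0] t.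

(* A message v or, for None, no message. *)
Definition message01 (k : nat) (v : option 'cV[R[i]]_k) (t : nat) : wvec k :=
  if v is Some v then message1 v t else vacuum.

Definition qubit (b : 'I_2) : 'cV[R[i]]_2 := delta_mx b 0.

Definition product (M : eqType) (f : forall w, wvec (wdim d w)) (m : M) :
    state R d M :=
  fun c m' => (\prod_(w <- wires) f w (c w)) * (m' == m)%:R.

Definition on_AB (f : wvec 2) (g : wvec d) : forall w, wvec (wdim d w) :=
  fun w => match w return wvec (wdim d w) with
           | wA => f | wB => g | _ => vacuum end.
Definition on_CE (f g : wvec d) : forall w, wvec (wdim d w) :=
  fun w => match w return wvec (wdim d w) with
           | wC => f | wE => g | _ => vacuum end.
Definition on_DF (f g : wvec d) : forall w, wvec (wdim d w) :=
  fun w => match w return wvec (wdim d w) with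
           | wD => f | wF => g | _ => vacuum end.
Definition on_GH (f : wvec 2) (g : wvec d) : forall w, wvec (wdim d w) :=
  fun w => match w return wvec (wdim d w) with
           | wG => f | wH => g | _ => vacuum end.
Definition no_message : forall w, wvec (wdim d w) := fun w => vacuum.

Definition symmetric_tensor (k n : nat) (psi : {ffun n.-tuple 'I_k -> R[i]}) :
    Prop :=
  forall x y : n.-tuple 'I_k, perm_eq x y -> psi x = psi y.

Definition tensor_power (k n : nat) (U : 'M[R[i]]_k)
    (psi : {ffun n.-tuple 'I_k -> R[i]}) : {ffun n.-tuple 'I_k -> R[i]} :=
  [ffun y => \sum_(x : n.-tuple 'I_k)
               (\prod_(j < n) U (tnth y j) (tnth x j)) * psi x].

Definition counting_gate (U : 'M[R[i]]_d) (I O : seq wire)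
    (on_in on_out : wvec d -> forall w, wvec (wdim d w))
    (S : system R d I O nat) : Prop :=
  forall t : nat, (1 <= t < 6)%N ->
    (forall i : nat,
       S t (product (on_in vacuum) i) = product (on_out vacuum) i) /\
    (forall (n : nat) (psi : {ffun n.-tuple 'I_d -> R[i]}) (i : nat),
       (1 <= n)%N -> symmetric_tensor psi ->
       S t (product (on_in (messages psi t)) i)
         = product (on_out (messages (tensor_power U psi) t.+1)) (i + n)%N).

Definition system_U := system R d [:: wC] [:: wD] nat.
Definition is_U (U : 'M[R[i]]_d) (S : system_U) : Prop :=
  counting_gate U (fun f => on_CE f vacuum) (fun f => on_DF f vacuum) S.

Definition system_V := system R d [:: wE] [:: wF] nat.
Definition is_V (V : 'M[R[i]]_d) (S : system_V) : Prop :=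
  counting_gate V (fun f => on_CE vacuum f) (fun f => on_DF vacuum f) S.

(* The register of QS is empty (None) before the control qubit has been
   received from A and after it has been sent on G. *)

Definition QS_register : choiceType := option 'I_2.

Definition system_QS :=
  system R d [:: wA; wB; wD; wF] [:: wC; wE; wG; wH] QS_register.

Record is_QS (S : system_QS) : Prop := IsQS {
  QS_1_0 : forall psi : 'cV[R[i]]_d,
    S 1%N (product (on_AB (message1 (qubit 0) 1) (message1 psi 1))
                   (None : QS_register))
      = product (on_CE vacuum (message1 psi 2)) (Some 0 : QS_register);
  QS_1_1 : forall psi : 'cV[R[i]]_d,
    S 1%N (product (on_AB (message1 (qubit 1) 1) (message1 psi 1))
                   (None : QS_register))
      = product (on_CE (message1 psi 2) vacuum) (Some 1 : QS_register);
  QS_3 : forall (psi phi : option 'cV[R[i]]_d) (q : 'I_2),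
    S 3%N (product (on_DF (message01 psi 3) (message01 phi 3))
                   (Some q : QS_register))
      = product (on_CE (message01 phi 4) (message01 psi 4))
                (Some q : QS_register);
  QS_5_0 : forall psi : 'cV[R[i]]_d,
    S 5%N (product (on_DF (message1 psi 5) vacuum) (Some 0 : QS_register))
      = product (on_GH (message1 (qubit 0) 6) (message1 psi 6))
                (None : QS_register);
  QS_5_1 : forall psi : 'cV[R[i]]_d,
    S 5%N (product (on_DF vacuum (message1 psi 5)) (Some 1 : QS_register))
      = product (on_GH (message1 (qubit 1) 6) (message1 psi 6))
                (None : QS_register);
  (* QS does nothing in the positions in which it does not expect messages. *)
  QS_even : forall (t : nat) (q : 'I_2), t \in [:: 2; 4]%N ->
    S t (product no_message (Some q : QS_register))
      = product no_message (Some q : QS_register)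
}.

(* The messages that a system outputs on a wire in position t + 1
   are consumed in the next round by the system at the other end of the wire.
   The three systems act on disjoint wires, positions and registers in a round,
   hence the order in a round does not matter.  There is no round for t = 6:
   its outputs would be in position 7. *)

Definition registers : Type := (QS_register * nat * nat)%type.

Definition round (QS : system_QS) (SU : system_U) (SV : system_V) (t : nat)
    (psi : state R d registers) : state R d registers :=
  step (fun r : registers => r.1.1) (fun q r => (q, r.1.2, r.2)) QS t
    (step (fun r : registers => r.1.2) (fun i r => (r.1.1, i, r.2)) SU t
      (step (fun r : registers => r.2) (fun i r => (r.1.1, r.1.2, i)) SV t
        psi)).

Definition composition (QS : system_QS) (SU : system_U) (SV : system_V)
    (psi : state R d registers) : state R d registers :=
  foldl (fun phi t => round QS SU SV t phi) psi (iota 1 5).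

End Vectors.

Arguments vacuum {R k}.
Arguments qubit R b : clear implicits.

(* Main.v *)
(** The state is kept as a superposition of two branches, one for each value of
    the control qubit, and in each branch it is a product state with a definite
    content of every wire.  A system acts only on the messages present on its
    input wires, so for fixed messages elsewhere the joint state is, in each
    branch, a multiple of the input on which the system is specified; linearity
    on the Fock space then gives the action on the superposition.  In branch 0
    the message goes through E, V, F, C, U, D to H, in branch 1 through C, U, D,
    E, V, F to H, and each gate is met once. *)

Require Import Defs.
From mathcomp Require Import all_boot all_order all_algebra.
From mathcomp Require Import all_classical all_reals all_analysis.
From mathcomp Require Import ring.

Set Implicit Arguments.
Unset Strict Implicit.
Unset Printing Implicit Defensive.

Import Order.TTheory GRing.Theory Num.Theory.

Local Open Scope ring_scope.
Local Open Scope complex_scope.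

Lemma mem_wires (w : wire) : w \in wires.
Proof. by case: w. Qed.

Lemma pos_eq (t t' : nat) :
  (1 <= t <= 6)%N -> (1 <= t' <= 6)%N -> (pos t == pos t') = (t == t').
Proof.
case: t => // t; case: t' => // t' /= ht ht'.
by rewrite -val_eqE /= !inordK.
Qed.

(** * Amplitudes of a single wire, and summability of states with finite support *)

Section Wires.
Variable R : realType.

Lemma vacuum_cat (k : nat) (s s' : seq (message k)) :
  vacuum (s ++ s') = vacuum s * vacuum s' :> R[i].
Proof. by rewrite /vacuum; case: s => [|x s] /=; rewrite ?mul1r ?mul0r. Qed.

Lemma message1E (k : nat) (v : 'cV[R[i]]_k) (t : nat) (s : seq (message k)) :
  message1 v t s = if s is [:: x] then v x.1 0 * (x.2 == pos t)%:R else 0.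
Proof.
rewrite /message1 /messages; case: s => [|x [|y s]] /=.
- by case: insubP => //= u.
- rewrite andbT /in_position; case: eqP => _; last by rewrite mulr0.
  case: insubP => [u /= _ hu|//].
  by rewrite ffunE (tnth_nth x.1) hu mulr1.
- by case: ifP => // _; case: insubP => //= u.
Qed.

Lemma message1_linear (k : nat) (a b : R[i]) (u v : 'cV[R[i]]_k) (t : nat)
    (s : seq (message k)) :
  message1 (a *: u + b *: v) t s = a * message1 u t s + b * message1 v t s.
Proof.
rewrite !message1E; case: s => [|x [|y s]]; rewrite ?mulr0 ?addr0 //.
by rewrite !mxE mulrDl !mulrA.
Qed.

(** One-tuples are in bijection with indices, so for [n = 1] the sum defining the tensor power is
    the matrix-vector product. *)
Lemma tensor_power1 (k : nat) (U : 'M[R[i]]_k) (v : 'cV[R[i]]_k) (t : nat) :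
  messages (tensor_power U [ffun u : 1.-tuple 'I_k => v (tnth u ord0) 0]) t
  = message1 (U *m v) t.
Proof.
rewrite /message1; congr messages; apply/ffunP => y; rewrite !ffunE mxE.
rewrite (reindex (fun i : 'I_k => [tuple i])) /=; last first.
  exists (fun u : 1.-tuple 'I_k => tnth u ord0) => [i _|u _].
    by rewrite (tnth_nth i).
  by case/tupleP: u => i u; rewrite (tuple0 u); apply: val_inj.
apply: eq_bigr => i _; rewrite big_ord1 ffunE.
by rewrite !(tnth_nth i).
Qed.

Lemma symmetric_tensor1 (k : nat) (psi : {ffun 1.-tuple 'I_k -> R[i]}) :
  symmetric_tensor psi.
Proof.
move=> x y xy; congr (psi _); apply: val_inj; apply: perm_small_eq => //.
by rewrite size_tuple.
Qed.

(** A wire with at most one message holds nothing or one of finitely many basis messages, so eight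
    options encode the whole configuration. *)
Lemma finite_small_configs (d : nat) (M : choiceType) (m : M) :
  finite_set [set x : config d * M |
    (forall w, size (x.1 w) <= 1)%N /\ x.2 = m].
Proof.
pose word k (o : option (message k)) : seq (message k) :=
  if o is Some y then [:: y] else [::].
pose D := (option (message 2) * option (message d) * option (message d)
  * option (message d) * option (message d) * option (message d)
  * option (message 2) * option (message d))%type.
pose decode (e : D) : config d * M :=
  let: (a, b, c, d', e, f, g, h) := e in
  (fun w => match w return seq (message (wdim d w)) with
   | wA => word _ a | wB => word _ b | wC => word _ c | wD => word _ d'
   | wE => word _ e | wF => word _ f | wG => word _ g | wH => word _ h end, m).
have wordK k (s : seq (message k)) : (size s <= 1)%N -> word _ (ohead s) = s.
  by case: s => [|y [|]].
apply: (@sub_finite_set _ _ (decode @` [set: D])); last first.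
  by apply: finite_image; apply: finite_finset.
move=> [c m'] /= [hc ->].
exists (ohead (c wA), ohead (c wB), ohead (c wC), ohead (c wD),
  ohead (c wE), ohead (c wF), ohead (c wG), ohead (c wH)) => //=.
congr pair; apply: functional_extensionality_dep => w.
by case: w; apply: wordK; apply: hc.
Qed.

(** The support lies in a finite set, so the sum of squared amplitudes reduces to a finite sum of
    finite terms. *)
Lemma square_summable_small (d : nat) (M : choiceType) (f : state R d M)
    (m0 : M) :
  (forall c m, f c m != 0 -> (forall w, size (c w) <= 1)%N /\ m = m0) ->
  square_summable f.
Proof.
move=> hf; rewrite /square_summable.
set A := ([set x : config d * M |
   (forall w, size (x.1 w) <= 1)%N /\ x.2 = m0])%classic.
have finA : finite_set A by exact: finite_small_configs.
set a := (X in (\esum_(x in _) X x)%E).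
have -> : a = (fun x => if x \in A then a x else 0%E).
  apply/funext => x; case: ifPn => // /negP xA; rewrite /a.
  have [->|/hf h] := eqVneq (f x.1 x.2) 0.
    by rewrite normr0 /= expr2 !mul0r.
  by case: xA; rewrite inE.
rewrite -esum_mkcond esum_fset //.
  by rewrite fsbig_finite //=; apply: lte_sum_pinfty => x _; rewrite ltry.
move=> x _; rewrite lee_fin divr_ge0 ?sqr_ge0 //.
Qed.

End Wires.

(** * Splitting the content of one wire according to position *)

Section Loads.
Variables (R : realType) (k : nat).
Implicit Types (v : 'cV[R[i]]_k) (s x : seq (message k)).

Lemma vacuum_perm s x : perm_eq s x -> vacuum s = vacuum x :> R[i].
Proof. by move=> sx; rewrite /vacuum -!size_eq0 (perm_size sx). Qed.

Lemma message1_perm v t s x : perm_eq s x -> message1 v t s = message1 v t x.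
Proof.
move=> sx; rewrite !message1E; case: x sx => [|a [|b x]] sx.
- by rewrite (perm_small_eq _ sx).
- by rewrite (perm_small_eq _ sx).
- by case: s sx => [|? [|? ?]] // /perm_size.
Qed.

(** The single message is in position [t] and [s] has none there, so it must come from [x], which
    forces [s] to be empty. *)
Lemma message1_cat_received v t x s :
  ~~ has (in_position (pos t)) s ->
  message1 v t (x ++ s) = message1 v t x * vacuum s.
Proof.
rewrite !message1E /vacuum; case: x => [|a [|b x]]; case: s => [|c [|e s]] //=;
  rewrite ?mul0r ?mulr0 ?mulr1 //.
by rewrite orbF /in_position => /negPf ->; rewrite mulr0.
Qed.

(** Dual case: [x] only has messages in position [t], so the message in position [p] must come from
    [s]. *)
Lemma message1_cat_kept v p t x s :
  pos p != pos t -> all (in_position (pos t)) x ->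
  message1 v p (x ++ s) = vacuum x * message1 v p s.
Proof.
move=> pt; rewrite !message1E /vacuum.
case: x => [|a [|b x]]; rewrite ?mul1r //= ?mul0r // andbT => /eqP ->.
by case: s => //=; rewrite eq_sym (negPf pt) mulr0.
Qed.

(* [Some (v, t)] is the message v in position t, [None] is the vacuum. *)
Definition load := option ('cV[R[i]]_k * nat).

Definition load_vec (l : load) : wvec R k :=
  if l is Some (v, t) then message1 v t else vacuum.

Definition due (t : nat) (l : load) : bool :=
  if l is Some (_, p) then p == t else false.

(** The function [pos] is injective only on this range; within it, comparing positions as numbers or
    as ordinals is the same. *)
Definition in_time (l : load) : bool :=
  if l is Some (_, p) then (1 <= p <= 6)%N else true.

Definition keep (b : bool) (l : load) : load := if b then l else None.

Lemma load_vec_perm l s x : perm_eq s x -> load_vec l s = load_vec l x.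
Proof. by case: l => [[v p]|]; [apply: message1_perm|apply: vacuum_perm]. Qed.

(** This is the isomorphism F(H1 (+) H2) = F(H1) (x) F(H2) for position [t] against all other
    positions. A load has at most one message, so one of the two factors is the vacuum. *)
Lemma load_vec_cat l t x s :
  (1 <= t <= 6)%N -> in_time l ->
  all (in_position (pos t)) x -> ~~ has (in_position (pos t)) s ->
  load_vec l (x ++ s)
  = load_vec (keep (due t l) l) x * load_vec (keep (~~ due t l) l) s.
Proof.
case: l => [[v p]|] /= ht hp hx hs; last by rewrite vacuum_cat.
case: eqVneq => [->|pt] /=; first exact: message1_cat_received.
by apply: (@message1_cat_kept _ _ t) => //; rewrite pos_eq.
Qed.

(** Bosonic symmetry allows the messages in position [t] to be moved to the front, where
    [load_vec_cat] applies. *)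
Lemma load_vec_filter l t s :
  (1 <= t <= 6)%N -> in_time l ->
  load_vec l s
  = load_vec (keep (due t l) l) [seq y <- s | in_position (pos t) y]
    * load_vec (keep (~~ due t l) l) [seq y <- s | ~~ in_position (pos t) y].
Proof.
move=> ht hl; rewrite -load_vec_cat ?filter_all //.
  by apply: load_vec_perm; rewrite perm_sym; exact/permPl/perm_filterC.
by apply/hasPn => y; rewrite mem_filter => /andP[].
Qed.

Lemma load_vec_size l s : load_vec l s != 0 -> (size s <= 1)%N.
Proof.
case: l => [[v p]|] /=; rewrite ?message1E /vacuum;
  by case: s => [|a [|b s]] //=; rewrite eqxx.
Qed.

Lemma load_vec_due l t s :
  due t l -> load_vec l s != 0 -> all (in_position (pos t)) s.
Proof.
case: l => [[v p]|] //= /eqP ->; rewrite message1E.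
case: s => [|a [|b s]] //=; rewrite ?eqxx // /in_position andbT.
by case: (a.2 == pos t); rewrite // mulr0 eqxx.
Qed.

Lemma load_vec_not_due l t s :
  (1 <= t <= 6)%N -> in_time l -> ~~ due t l ->
  has (in_position (pos t)) s -> load_vec l s = 0.
Proof.
move=> ht hl nd hs; apply/eqP; apply: contraTT hs.
case: l hl nd => [[v p]|] /= hp nd; rewrite ?message1E /vacuum;
  case: s => [|a [|b s]] //=; rewrite ?eqxx // /in_position orbF.
apply: contraNN => /eqP ->; rewrite pos_eq // [t == p]eq_sym (negPf nd).
by rewrite mulr0.
Qed.

End Loads.
Arguments load : clear implicits.

(** * Product states with definite wire contents, and the action of one system on a superposition of
    two of them *)

Section Cargo.
Variables (R : realType) (d : nat).

Definition cargo := forall w, load R (wdim d w).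
Implicit Types (F G : cargo) (c : config d).

Definition carried (M : eqType) F (m : M) : state R d M :=
  product (fun w => load_vec (F w)) m.

Lemma fock_carried (I : seq wire) (t : nat) (M : choiceType) F (m : M)
    (a : R[i]) :
  (forall w, if w \in I then (F w == None) || due t (F w) else F w == None) ->
  fock I (pos t) (fun c m' => a * carried F m c m').
Proof.
move=> hF; have factor c m' w : a * carried F m c m' != 0 ->
    load_vec (F w) (c w) != 0.
  rewrite mulf_eq0 negb_or => /andP[_].
  rewrite mulf_eq0 negb_or => /andP[h _]; move: h.
  by rewrite prodf_seq_neq0 => /allP /(_ _ (mem_wires w)).
split.
- move=> c c' m' cc'; congr (_ * (_ * _)).
  by apply: eq_bigr => w _; apply: load_vec_perm.
- apply: (square_summable_small (m0 := m)) => c m' h; split.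
    by move=> w; apply: load_vec_size (factor _ _ w h).
  apply/eqP; apply: contraNT h => /negPf h.
  by rewrite /carried /product h !mulr0.
- move=> c m'; apply: contraNeq => h; apply/allP => w _.
  have := factor _ _ w h; have := hF w; case: ifP => _.
    case/orP => [/eqP -> /=|]; last exact: load_vec_due.
    by rewrite /vacuum; case: (c w) => //=; rewrite eqxx.
  by move=> /eqP -> /=; rewrite /vacuum; case: (c w) => //=; rewrite eqxx.
Qed.

Variables (I O : seq wire) (t : nat).

Definition received F : cargo :=
  fun w => keep ((w \in I) && due t (F w)) (F w).

Definition remaining F : cargo :=
  fun w => keep (~~ ((w \in I) && due t (F w))) (F w).

(** Giving [G] priority loses nothing: [deliverable] makes [F w] empty wherever [G w] is a
    message. *)
Definition delivered F G : cargo :=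
  fun w => if G w is Some l then Some l else remaining F w.

(* The outputs G in position t + 1 can be added to the messages F in transit:
   the output wires are free and inputs and outputs use different wires. *)
Definition deliverable F G (w : wire) : bool :=
  in_time (F w) &&
  (if w \in O then
     [&& w \notin I, ~~ due t.+1 (F w)
       & if G w is Some (_, p) then (p == t.+1) && (F w == None) else true]
   else G w == None).

Variables (M : choiceType) (N : eqType).
Variables (get : N -> M) (put : M -> N -> N).
Hypothesis ht : (1 <= t < 6)%N.
Hypothesis get_put : forall i m, get (put i m) = i.
Hypothesis put_get : forall m, put (get m) m = m.
Hypothesis put_put : forall i j m, put i (put j m) = put i m.

Let ht6 : (1 <= t <= 6)%N. Proof. by case/andP: ht => -> /ltnW. Qed.
Let ht1 : (1 <= t.+1 <= 6)%N. Proof. by case/andP: ht. Qed.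

Lemma fock_received F (m : M) (a : R[i]) :
  fock I (pos t) (fun c m' => a * carried (received F) m c m').
Proof.
apply: fock_carried => w; rewrite /received.
by case: (w \in I); case h: (due t (F w)) => //=; rewrite h orbT.
Qed.

(** A register content splits into the component of the system and the rest; [put (get m) m0 == m]
    says that [m0] and [m] agree on the rest. *)
Lemma put_eq i m m0 : (put i m == m0) = (i == get m0) && (put (get m) m0 == m).
Proof.
apply/eqP/andP => [<-|[/eqP -> /eqP <-]];
  first by rewrite get_put put_put put_get.
by rewrite put_put put_get.
Qed.

Lemma eq_put i m m0 : (m == put i m0) = (put (get m) m0 == m) && (get m == i).
Proof.
by apply/eqP/andP => [->|[/eqP h /eqP <-]]; rewrite ?get_put ?put_put.
Qed.

(** The witness [G] is the output of the system alone. [F'] is fixed wire by wire, so that explicit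
    cargos can be checked by cases on the wire. *)
Definition transit (S : system R d I O M) F (i : M) F' (i' : M) : Prop :=
  exists2 G, forall w, deliverable F G w /\ F' w = delivered F G w
  & S t (carried (received F) i) = carried G i'.

Let rest c : config d := fun w =>
  if w \in O then [seq y <- c w | ~~ in_position (pos t.+1) y] else c w.
Let output c : config d := fun w =>
  if w \in O then [seq y <- c w | in_position (pos t.+1) y] else [::].

(** The amplitude of everything outside the reach of the system; for fixed [c] and [m] it is a
    scalar. *)
Definition bystanders F (m0 : N) c (m : N) : R[i] :=
  (\prod_(w <- wires) load_vec (remaining F w) (rest c w))
  * (put (get m) m0 == m)%:R.

(** On an input wire [x] has all messages in position [t] and [c] has none, so the load factors; on
    any other wire [x] is empty. The factors that depend on [c] and [m] only make up
    [bystanders]. *)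
Lemma slice_carried F G m0 c m :
  (forall w, deliverable F G w) ->
  ~~ has (fun w => (w \in I) && has (in_position (pos t)) (c w)) wires ->
  (fun x i => if located I (pos t) x then
      carried F m0 (fun w => x w ++ rest c w) (put i m) else 0)
  = (fun x i => bystanders F m0 c m * carried (received F) (get m0) x i).
Proof.
move=> hFG /hasPn hc; apply/funext => x; apply/funext => i.
have [_ _ fockF] := fock_received F (get m0) (bystanders F m0 c m).
(* For an [x] that is not located on the inputs, the right side vanishes too, since the received
   state lies in the input Fock space. *)
case: ifPn => [/allP hx|/fockF -> //].
rewrite /carried /product put_eq -mulnb natrM /bystanders.
rewrite (eq_bigr (fun w => load_vec (received F w) (x w)
   * load_vec (remaining F w) (rest c w))); last first.
  move=> w _; have := hx w (mem_wires w); have := hc w (mem_wires w).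
  case/andP: (hFG w) => hF; rewrite /received /remaining /rest.
  case: (boolP (w \in I)) => /= wI.
    have -> : (w \in O) = false
      by apply/negP => wO; have := hFG w; rewrite /deliverable wO wI andbF.
    by move=> _ hs hxw; apply: load_vec_cat.
  by move=> _ _ /eqP ->; rewrite /= mul1r.
rewrite big_split /=; ring.
Qed.

(** On an output wire the amplitude is split at position [t.+1]: either [G] puts its message on an
    empty wire, or [F] has nothing in that position. On all other wires [G] is the vacuum. *)
Lemma delivered_vec F G c w :
  deliverable F G w ->
  ~~ ((w \in I) && has (in_position (pos t)) (c w)) ->
  load_vec (delivered F G w) (c w)
  = load_vec (remaining F w) (rest c w) * load_vec (G w) (output c w).
Proof.
rewrite /deliverable /delivered /remaining /rest /output => /andP[hF].
case: ifP => wO.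
  case/and3P => /negPf -> /= nd hG _; case: (G w) hG => [[v p]|] /=.
    case/andP => /eqP -> /eqP -> /=.
    have := @load_vec_filter R _ (Some (v, t.+1)) t.+1 (c w) ht1 ht1.
    by rewrite /= eqxx /= mulrC.
  move=> _; rewrite (load_vec_filter (c w) ht1 hF) (negPf nd) /=.
  exact: mulrC.
by move=> /eqP -> /= _; rewrite mulr1.
Qed.

(** An input wire is not an output wire, so only [remaining] messages are left on it, none of them
    in position [t]. This matches the zero branch of [step]. *)
Lemma delivered_consumed F G c w :
  deliverable F G w -> w \in I -> has (in_position (pos t)) (c w) ->
  load_vec (delivered F G w) (c w) = 0.
Proof.
rewrite /deliverable /delivered /remaining => /andP[hF].
case: ifP => [_ /and3P[/negPf -> //]|_ /eqP -> wI hc]; rewrite wI /=.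
apply: (load_vec_not_due ht6 _ _ hc); case h: (due t (F w)) => //=.
by rewrite h.
Qed.

(* Conditioned on what the system does not see, the joint state is a multiple of
   the received state, so that linearity reduces the joint action to S. *)
Lemma step_superposition (S : system R d I O M) F1 F1' F2 F2' i1 i2 m1 m2
    (a b : R[i]) :
  transit S F1 (get m1) F1' i1 -> transit S F2 (get m2) F2' i2 ->
  step get put S t (fun c m => a * carried F1 m1 c m + b * carried F2 m2 c m)
  = (fun c m => a * carried F1' (put i1 m1) c m
              + b * carried F2' (put i2 m2) c m).
Proof.
move=> [G1 h1 S1] [G2 h2 S2]; apply/funext => c; apply/funext => m.
(* Each target branch is brought into the shape of [step]: zero if an input message is left,
   otherwise the scalar [bystanders] times the output of the system. *)
have result F F' G m0 i :
    (forall w, deliverable F G w /\ F' w = delivered F G w) ->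
    carried F' (put i m0) c m =
    if has (fun w => (w \in I) && has (in_position (pos t)) (c w)) wires then 0
    else bystanders F m0 c m * carried G i (output c) (get m).
  move=> h; rewrite /carried /product; case: ifPn => [/hasP[w _ /andP[wI hw]]|].
    rewrite (_ : \prod_(_ <- _) _ = 0) ?mul0r //; apply/eqP.
    rewrite prodf_seq_eq0; apply/hasP; exists w; first exact: mem_wires.
    by have [hd ->] := h w; rewrite delivered_consumed ?eqxx.
  move=> /hasPn hc; rewrite eq_put.
  rewrite /bystanders.
  rewrite (eq_bigr (fun w => load_vec (remaining F w) (rest c w)
     * load_vec (G w) (output c w))); last first.
    move=> w _; have [hd ->] := h w; apply: delivered_vec => //.
    exact: hc (mem_wires w).
  rewrite big_split /= -mulnb natrM; ring.
rewrite (result _ _ _ _ _ h1) (result _ _ _ _ _ h2) /step; case: ifPn => hc.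
  by rewrite !mulr0 addr0.
rewrite -S1 -S2.
(* Linearity is stated for [a * f + g], so homogeneity comes from writing [k * f] as
   [(k - 1) * f + f]. *)
have actZ F k m0 : S t (fun c' m' => k * carried (received F) m0 c' m')
    = (fun c' m' => k * S t (carried (received F) m0) c' m').
  have fock1 : fock I (pos t) (carried (received F) m0).
    have := fock_received F m0 1; congr fock.
    by do 2!apply/funext => ?; rewrite mul1r.
  transitivity (S t (fun c' m' => (k - 1) * carried (received F) m0 c' m'
      + carried (received F) m0 c' m')).
    by congr (act S t); do 2!apply/funext => ?; ring.
  rewrite act_linear //; try exact: fock_received.
  by do 2!apply/funext => ?; ring.
transitivity (S t (fun x i =>
    a * (bystanders F1 m1 c m * carried (received F1) (get m1) x i)
    + (b * bystanders F2 m2 c m) * carried (received F2) (get m2) x i)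
    (output c) (get m)).
  congr (act S t _ _ _); apply/funext => x; apply/funext => i.
  have /(congr1 (fun f => f x i)) /= :=
    slice_carried m1 m (fun w => proj1 (h1 w)) hc.
  have /(congr1 (fun f => f x i)) /= :=
    slice_carried m2 m (fun w => proj1 (h2 w)) hc.
  by rewrite -mulrA => <- <-; case: ifP => _ //; rewrite !mulr0 addr0.
rewrite act_linear //; try exact: fock_received.
rewrite !actZ; ring.
Qed.

End Cargo.

(** * The behaviour of each system on the cargos that occur *)

Section Transits.
Variables (R : realType) (d : nat).

Lemma eq_product (M : eqType) (f g : forall w, wvec R (wdim d w)) (m : M) :
  (forall w, f w = g w) -> product f m = product g m.
Proof. by move=> fg; congr (product _ m); apply: functional_extensionality_dep. Qed.

Lemma transitI (I O : seq wire) (t : nat) (M : choiceType)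
    (S : system R d I O M) (f g : forall w, wvec R (wdim d w)) (i i' : M)
    (G F F' : cargo R d) :
  S t (product f i) = product g i' ->
  (forall w, load_vec (received I t F w) = f w) ->
  (forall w, load_vec (G w) = g w) ->
  (forall w, deliverable I O t F G w) ->
  (forall w, F' w = delivered I t F G w) ->
  transit t S F i F' i'.
Proof.
move=> Sfg Ff Gg hd hF'; exists G => [w|]; first by split.
by rewrite /carried (eq_product _ Ff) (eq_product _ Gg).
Qed.

(** With nothing due on the inputs, the received state is the vacuum, and the output added to the
    cargo is empty. *)
Lemma transit_idle (I O : seq wire) (t : nat) (M : choiceType)
    (S : system R d I O M) (F : cargo R d) (i : M) :
  S t (product (@no_message R d) i) = product (@no_message R d) i ->
  (forall w, in_time (F w)) ->
  (forall w, w \in I -> ~~ due t (F w)) ->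
  (forall w, w \in O -> (w \notin I) && ~~ due t.+1 (F w)) ->
  transit t S F i F i.
Proof.
move=> hS inF dueI dueO.
have notdue w : (w \in I) && due t (F w) = false.
  by apply/negP => /andP[/dueI/negPf ->].
apply: (transitI (G := fun=> None) hS) => // w.
- by rewrite /received notdue.
- by rewrite /deliverable inF; case: ifP => // /dueO/andP[-> ->].
- by rewrite /delivered /remaining notdue.
Qed.

(** Between entry and exit each branch has exactly one message, on one of the wires C, D, E, F. The
    match is needed because the type of a load depends on the wire. *)
Definition internal (w0 : wire) (v : 'cV[R[i]]_d) (t : nat) : cargo R d :=
  fun w => match w return load R (wdim d w) with
  | wC => keep (w0 == wC) (Some (v, t)) | wD => keep (w0 == wD) (Some (v, t))
  | wE => keep (w0 == wE) (Some (v, t)) | wF => keep (w0 == wF) (Some (v, t))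
  | _ => None end.

Lemma internal_in_time w0 v t :
  (1 <= t <= 6)%N -> forall w, in_time (internal w0 v t w).
Proof. by move=> ht; case => //=; case: (w0 == _). Qed.

Definition external_in (q : 'cV[R[i]]_2) (v : 'cV[R[i]]_d) : cargo R d :=
  fun w => match w return load R (wdim d w) with
  | wA => Some (q, 1%N) | wB => Some (v, 1%N) | _ => None end.

Definition external_out (q : 'cV[R[i]]_2) (v : 'cV[R[i]]_d) : cargo R d :=
  fun w => match w return load R (wdim d w) with
  | wG => Some (q, 6%N) | wH => Some (v, 6%N) | _ => None end.

Section Gates.
Variables (U V : 'M[R[i]]_d) (SU : system_U R d) (SV : system_V R d).
Hypotheses (hU : is_U U SU) (hV : is_V V SV).
Variable t : nat.
Hypothesis ht : (1 <= t < 6)%N.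

Lemma U_idle (F : cargo R d) i :
  (forall w, in_time (F w)) -> ~~ due t (F wC) -> ~~ due t.+1 (F wD) ->
  transit t SU F i F i.
Proof.
move=> inF dueC dueD; apply: transit_idle => //; try by case.
have [/(_ i) + _] := hU ht.
by rewrite !(@eq_product _ _ (@no_message R d)) //; case.
Qed.

Lemma V_idle (F : cargo R d) i :
  (forall w, in_time (F w)) -> ~~ due t (F wE) -> ~~ due t.+1 (F wF) ->
  transit t SV F i F i.
Proof.
move=> inF dueE dueF; apply: transit_idle => //; try by case.
have [/(_ i) + _] := hV ht.
by rewrite !(@eq_product _ _ (@no_message R d)) //; case.
Qed.

(** The case [n = 1] of the gate specification, where the symmetry condition is automatic and the
    counter grows by one. *)
Lemma U_query v i :
  transit t SU (internal wC v t) i (internal wD (U *m v) t.+1) i.+1.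
Proof.
have [_ /(_ 1%N _ i isT (symmetric_tensor1 _))] := hU ht.
move=> /(_ [ffun u => v (tnth u ord0) 0]).
rewrite tensor_power1 addn1 => hS.
have ht6 : (1 <= t <= 6)%N by case/andP: ht => -> /ltnW.
by apply: (transitI (G := internal wD (U *m v) t.+1) hS);
  case; rewrite /received /deliverable /delivered /remaining /= ?eqxx
    ?ht6 //= ?eqxx.
Qed.

Lemma V_query v i :
  transit t SV (internal wE v t) i (internal wF (V *m v) t.+1) i.+1.
Proof.
have [_ /(_ 1%N _ i isT (symmetric_tensor1 _))] := hV ht.
move=> /(_ [ffun u => v (tnth u ord0) 0]).
rewrite tensor_power1 addn1 => hS.
have ht6 : (1 <= t <= 6)%N by case/andP: ht => -> /ltnW.
by apply: (transitI (G := internal wF (V *m v) t.+1) hS);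
  case; rewrite /received /deliverable /delivered /remaining /= ?eqxx
    ?ht6 //= ?eqxx.
Qed.
End Gates.

Section Switch.
Variable QS : system_QS R d.
Hypothesis hQS : is_QS QS.
Implicit Type v : 'cV[R[i]]_d.

Lemma QS_idle F (q : 'I_2) t : t \in [:: 2; 4]%N ->
  (forall w, in_time (F w)) ->
  (forall w, w \in [:: wA; wB; wD; wF] -> ~~ due t (F w)) ->
  (forall w, w \in [:: wC; wE; wG; wH] -> ~~ due t.+1 (F w)) ->
  transit t QS F (Some q) F (Some q).
Proof.
move=> h24 inF dueI dueO; apply: transit_idle => //; first exact: QS_even.
by move=> w /[dup] /dueO ->; case: w.
Qed.

Lemma QS_enter0 v :
  transit 1 QS (external_in (qubit R 0) v) None (internal wE v 2) (Some 0).
Proof.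
by apply: (transitI (G := internal wE v 2) (QS_1_0 hQS v)); case.
Qed.

Lemma QS_enter1 v :
  transit 1 QS (external_in (qubit R 1) v) None (internal wC v 2) (Some 1).
Proof.
by apply: (transitI (G := internal wC v 2) (QS_1_1 hQS v)); case.
Qed.

Lemma QS_forward_DE v q :
  transit 3 QS (internal wD v 3) (Some q) (internal wE v 4) (Some q).
Proof.
by apply: (transitI (G := internal wE v 4) (QS_3 hQS (Some v) None q)); case.
Qed.

Lemma QS_forward_FC v q :
  transit 3 QS (internal wF v 3) (Some q) (internal wC v 4) (Some q).
Proof.
by apply: (transitI (G := internal wC v 4) (QS_3 hQS None (Some v) q)); case.
Qed.

Lemma QS_exit0 v :
  transit 5 QS (internal wD v 5) (Some 0) (external_out (qubit R 0) v) None.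
Proof.
by apply: (transitI (G := external_out (qubit R 0) v) (QS_5_0 hQS v)); case.
Qed.

Lemma QS_exit1 v :
  transit 5 QS (internal wF v 5) (Some 1) (external_out (qubit R 1) v) None.
Proof.
by apply: (transitI (G := external_out (qubit R 1) v) (QS_5_1 hQS v)); case.
Qed.
End Switch.

(** * Complete rounds, branch by branch *)

Section Rounds.
Variables (QS : system_QS R d) (SU : system_U R d) (SV : system_V R d).

(** The intermediate cargos follow the order of [round]: first [SV], then [SU], then [QS], each with
    its own register component. *)
Definition round_transit (t : nat) (F : cargo R d) (r : registers)
    (F' : cargo R d) (r' : registers) : Prop :=
  exists F1 F2, [/\ transit t SV F r.2 F1 r'.2, transit t SU F1 r.1.2 F2 r'.1.2
    & transit t QS F2 r.1.1 F' r'.1.1].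

Lemma round_superposition t F1 r1 F1' r1' F2 r2 F2' r2' (a b : R[i]) :
  (1 <= t < 6)%N ->
  round_transit t F1 r1 F1' r1' -> round_transit t F2 r2 F2' r2' ->
  round QS SU SV t (fun c r => a * carried F1 r1 c r + b * carried F2 r2 c r)
  = (fun c r => a * carried F1' r1' c r + b * carried F2' r2' c r).
Proof.
move: r1 r1' r2 r2' => [[q1 u1] v1] [[q1' u1'] v1'] [[q2 u2] v2] [[q2' u2'] v2'].
move=> ht [G1 [H1 [/= V1 U1 Q1]]] [G2 [H2 [/= V2 U2 Q2]]]; rewrite /round.
rewrite (@step_superposition _ _ _ _ t _ _ (fun r : registers => r.2) _ ht
  _ _ _ _ _ _ _ _ _ _ (q1, u1, v1) (q2, u2, v2) _ _ V1 V2) //=;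
  try by case=> [[]].
(* From here on the registers contain the updated counter of [SV]. *)
rewrite (@step_superposition _ _ _ _ t _ _ (fun r : registers => r.1.2) _ ht
  _ _ _ _ _ _ _ _ _ _ (q1, u1, v1') (q2, u2, v2') _ _ U1 U2) //=;
  try by case=> [[]].
by rewrite (@step_superposition _ _ _ _ t _ _ (fun r : registers => r.1.1) _ ht
  _ _ _ _ _ _ _ _ _ _ (q1, u1', v1') (q2, u2', v2') _ _ Q1 Q2) //=; case=> [[]].
Qed.

Variables (U V : 'M[R[i]]_d).
Hypotheses (hQS : is_QS QS) (hSU : is_U U SU) (hSV : is_V V SV).

Lemma round_enter0 v : round_transit 1 (external_in (qubit R 0) v)
    (None, 0%N, 0%N) (internal wE v 2) (Some 0, 0%N, 0%N).
Proof.
exists (external_in (qubit R 0) v), (external_in (qubit R 0) v); split.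
- by apply: (V_idle hSV) => //; case.
- by apply: (U_idle hSU) => //; case.
- exact: QS_enter0.
Qed.

Lemma round_enter1 v : round_transit 1 (external_in (qubit R 1) v)
    (None, 0%N, 0%N) (internal wC v 2) (Some 1, 0%N, 0%N).
Proof.
exists (external_in (qubit R 1) v), (external_in (qubit R 1) v); split.
- by apply: (V_idle hSV) => //; case.
- by apply: (U_idle hSU) => //; case.
- exact: QS_enter1.
Qed.

(** [SV] acts first, so [SU] and [QS] see the message already on F in position [t.+1]. It is not due
    at [t], so [QS] does not pick it up in the same round. *)
Lemma round_queryV v t q i j : t \in [:: 2; 4]%N ->
    round_transit t (internal wE v t) (Some q, i, j)
      (internal wF (V *m v) t.+1) (Some q, i, j.+1).
Proof.
move=> h24; have ht : (1 <= t < 6)%N by case/predU1P: h24 => [->|/predU1P[->|]].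
have [ht6 ht1] : (1 <= t <= 6)%N /\ (1 <= t.+1 <= 6)%N.
  by case/andP: ht => -> /[dup] /ltnW.
exists (internal wF (V *m v) t.+1), (internal wF (V *m v) t.+1); split => /=.
- exact: V_query.
- by apply: (U_idle hSU) => //; apply: internal_in_time.
- apply: (QS_idle hQS) => //; first exact: internal_in_time.
    by case=> //= _; rewrite eqn_leq ltnn.
  by case.
Qed.

Lemma round_queryU v t q i j : t \in [:: 2; 4]%N ->
    round_transit t (internal wC v t) (Some q, i, j)
      (internal wD (U *m v) t.+1) (Some q, i.+1, j).
Proof.
move=> h24; have ht : (1 <= t < 6)%N by case/predU1P: h24 => [->|/predU1P[->|]].
have [ht6 ht1] : (1 <= t <= 6)%N /\ (1 <= t.+1 <= 6)%N.
  by case/andP: ht => -> /[dup] /ltnW.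
exists (internal wC v t), (internal wD (U *m v) t.+1); split => /=.
- by apply: (V_idle hSV) => //; apply: internal_in_time.
- exact: U_query.
- apply: (QS_idle hQS) => //; first exact: internal_in_time.
    by case=> //= _; rewrite eqn_leq ltnn.
  by case.
Qed.

Lemma round_forward0 v i j : round_transit 3 (internal wF v 3)
    (Some 0, i, j) (internal wC v 4) (Some 0, i, j).
Proof.
exists (internal wF v 3), (internal wF v 3); split.
- by apply: (V_idle hSV) => //; case.
- by apply: (U_idle hSU) => //; case.
- exact: QS_forward_FC.
Qed.

Lemma round_forward1 v i j : round_transit 3 (internal wD v 3)
    (Some 1, i, j) (internal wE v 4) (Some 1, i, j).
Proof.
exists (internal wD v 3), (internal wD v 3); split.
- by apply: (V_idle hSV) => //; case.
- by apply: (U_idle hSU) => //; case.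
- exact: QS_forward_DE.
Qed.

Lemma round_exit0 v i j : round_transit 5 (internal wD v 5)
    (Some 0, i, j) (external_out (qubit R 0) v) (None, i, j).
Proof.
exists (internal wD v 5), (internal wD v 5); split.
- by apply: (V_idle hSV) => //; case.
- by apply: (U_idle hSU) => //; case.
- exact: QS_exit0.
Qed.

Lemma round_exit1 v i j : round_transit 5 (internal wF v 5)
    (Some 1, i, j) (external_out (qubit R 1) v) (None, i, j).
Proof.
exists (internal wF v 5), (internal wF v 5); split.
- by apply: (V_idle hSV) => //; case.
- by apply: (U_idle hSU) => //; case.
- exact: QS_exit1.
Qed.

End Rounds.

End Transits.

Theorem lemma8p1 (R : realType) (d : nat) (U V : 'M[R[i]]_d)
    (hU : U \is unitarymx) (hV : V \is unitarymx)
    (QS : system_QS R d) (SU : system_U R d) (SV : system_V R d)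
    (hQS : is_QS QS) (hSU : is_U U SU) (hSV : is_V V SV) :
  forall (alpha beta : R[i]) (psi : 'cV[R[i]]_d),
    composition QS SU SV
      (product
         (on_AB (message1 (alpha *: qubit R 0 + beta *: qubit R 1) 1)
                (message1 psi 1))
         ((None, 0%N, 0%N) : registers))
    = (fun c r =>
         alpha *
           product (on_GH (message1 (qubit R 0) 6)
                          (message1 (U *m (V *m psi)) 6))
                   ((None, 1%N, 1%N) : registers) c r
         + beta *
           product (on_GH (message1 (qubit R 1) 6)
                          (message1 (V *m (U *m psi)) 6))
                   ((None, 1%N, 1%N) : registers) c r).
Proof.
move=> a b psi.
(* The product is linear in the message on A, which separates the two branches of the control
   qubit. *)
have -> : product (on_AB (message1 (a *: qubit R 0 + b *: qubit R 1) 1)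
      (message1 psi 1)) ((None, 0%N, 0%N) : registers)
    = (fun c r => a * carried (external_in (qubit R 0) psi) (None, 0%N, 0%N) c r
        + b * carried (external_in (qubit R 1) psi) (None, 0%N, 0%N) c r).
  apply/funext => c; apply/funext => r.
  rewrite /carried /product /wires !big_cons !big_nil /= message1_linear; ring.
rewrite /composition /=.
rewrite (round_superposition _ _ _ (round_enter0 hQS hSU hSV _)
  (round_enter1 hQS hSU hSV _)) //.
rewrite (round_superposition _ _ _ (round_queryV hQS hSU hSV _ _ _ _ (t := 2) isT)
  (round_queryU hQS hSU hSV _ _ _ _ (t := 2) isT)) //.
rewrite (round_superposition _ _ _ (round_forward0 hQS hSU hSV _ _ _)
  (round_forward1 hQS hSU hSV _ _ _)) //.
(* So far the counters of [SU] and [SV] are 0 and 1 in the first branch, 1 and 0 in the second. This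
   second query makes both counters 1 in both branches, so they factor out of the superposition. *)
rewrite (round_superposition _ _ _ (round_queryU hQS hSU hSV _ _ _ _ (t := 4) isT)
  (round_queryV hQS hSU hSV _ _ _ _ (t := 4) isT)) //.
rewrite (round_superposition _ _ _ (round_exit0 hQS hSU hSV _ _ _)
  (round_exit1 hQS hSU hSV _ _ _)) //.
have out q v (r : registers) : carried (external_out q v) r
    = product (on_GH (message1 q 6) (message1 v 6)) r.
  by apply: eq_product; case.
by rewrite !out.
Qed.
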